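(* Let $RR$ be a $Jf$-relative monad, let $LM$ be a left $RR$-module with values in sets, and let $C(RR,LM)$ be the associated C-system. Put $Ob=Ob(C(RR,LM))$ and $\widetilde{Ob}'=\coprod_{n\in\mathbb N}Ob_{n+1}(RR,LM)\times RR(n)$. Let $T',\widetilde T',S',\widetilde S',\delta'$ be the operations obtained from the operations $T,\widetilde T,S,\widetilde S,\delta$ of the C-system $C(RR,LM)$ by transport along the identity of $Ob$ and the bijection $mb:\widetilde{Ob}(C(RR,LM))\to\widetilde{Ob}'$. Then: 1. $T'$ is defined on the set of pairs $(m,\Gamma),(n,\Gamma')\in Ob$, where $\Gamma=(T_0,\dots,T_{m-1})$, $\Gamma'=(T'_0,\dots,T'_{n-1})$, such that $m>0$, $n>m-1$ and $T_i=T'_i$ for $i=0,\dots,m-2$. It takes values in $Ob$ and is given by $$T'((m,\Gamma),(n,\Gamma'))=(n+1,(T_0,\dots,T_{m-2},T_{m-1},\partial^{m-1}_{m-1}(T'_{m-1}),\dots,\partial^{m-1}_{n-1}(T'_{n-1}))).$$ 2. $\widetilde T'$ is defined on the set of pairs $(m,\Gamma)\in Ob$, $(n,(\Gamma',s))\in\widetilde{Ob}'$, where $\Gamma=(T_0,\dots,T_{m-1})$, $\Gamma'=(T'_0,\dots,T'_{n})$, such that $m>0$, $n+1>m-1$ and $T_i=T_i'$ for $i=0,\dots,m-2$. It takes values in $\widetilde{Ob}'$ and is given by $$\widetilde T'((m,\Gamma),(n,(\Gamma',s)))=(n+1,(T'((m,\Gamma),(n+1,\Gamma')),\partial^{m-1}_n(s))).$$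 3. $S'$ is defined on the set of pairs $(m,(\Gamma,r))\in\widetilde{Ob}'$, $(n,\Gamma')\in Ob$, where $\Gamma=(T_0,\dots,T_m)$, $\Gamma'=(T'_0,\dots,T'_{n-1})$, such that $n>m+1$ and $T_i=T'_i$ for $i=0,\dots,m$. It takes values in $Ob$ and is given by $$S'((m,(\Gamma,r)),(n,\Gamma'))=(n-1,(T'_0,\dots,T'_{m-1},\theta_{m,m+1}(r,T'_{m+1}),\theta_{m,m+2}(r,T'_{m+2}),\dots,\theta_{m,n-1}(r,T'_{n-1}))).$$ 4. $\widetilde S'$ is defined on the set of pairs $(m,(\Gamma,r))\in\widetilde{Ob}'$, $(n,(\Gamma',s))\in\widetilde{Ob}'$, where $\Gamma=(T_0,\dots,T_m)$, $\Gamma'=(T'_0,\dots,T'_n)$, such that $n>m$ and $T_i=T'_i$ for $i=0,\dots,m$. It takes values in $\widetilde{Ob}'$ and is given by $$\widetilde S'((m,(\Gamma,r)),(n,(\Gamma',s)))=(n-1,(S'((m,(\Gamma,r)),(n+1,\Gamma')),\theta_{m,n}(r,s))).$$ 5. $\delta'$ is defined on the set of $(m,\Gamma)\in Ob$ such that $m>0$. It takes values in $\widetilde{Ob}'$ and is given by $$\delta'((m,\Gamma))=(m,(T'((m,\Gamma),(m,\Gamma)),x^m_{m-1})).$$ (In 2, 4, 5, where a value $(k,\Delta)\in Ob$ of $T'$ or $S'$ appears as first component of a pair in $Ob_k(RR,LM)\times RR(k-1)$, it stands for the sequence $\Delta\in Ob_k(RR,LM)$.)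
   Context: Composition is in diagrammatic order: $f\circ g$ means first $f$, then $g$. C-systems. A C0-system is a category $CC$ with a length function $l:Ob(CC)\to\mathbb N$, an object $pt$, a function $ft:Ob(CC)\to Ob(CC)$, morphisms $p_X:X\to ft(X)$, and, for $l(X)>0$ and $f:Y\to ft(X)$, an object $f^*(X)$ and a morphism $q(f,X):f^*(X)\to X$, such that: $l^{-1}(0)=\{pt\}$; $l(ft(X))=l(X)-1$ if $l(X)>0$; $ft(pt)=pt$; $pt$ is final; $l(f^*(X))>0$, $ft(f^*(X))=Y$ and $q(f,X)\circ p_X=p_{f^*(X)}\circ f$; $Id_{ft(X)}^*(X)=X$ and $q(Id_{ft(X)},X)=Id_X$; and for $g:Z\to Y$, $(g\circ f)^*(X)=g^*(f^*(X))$ and $q(g\circ f,X)=q(g,f^*(X))\circ q(f,X)$. A C-system is a C0-system with an operation assigning to each $f:Y\to X$ with $l(X)>0$ a morphism $s_f:Y\to(ft(f))^*(X)$, where $ft(f)=f\circ p_X$, such that $s_f\circ p_{(ft(f))^*(X)}=Id_Y$, $f=s_f\circ q(ft(f),X)$, and $s_f=s_{f\circ q(g,Z)}$ whenever $X=g^*(Z)$ with $g:ft(X)\to ft(Z)$. Such an operation is unique if it exists, and it exists iff all squares formed by $q(f,X),p_X,p_{f^*(X)},f$ are pull-backs. Write $\Gamma\le\Gamma'$ (''$\Gamma'$ is over $\Gamma$'') if $l(\Gamma)\le l(\Gamma')$ and $\Gamma=ft^{l(\Gamma')-l(\Gamma)}(\Gamma')$; $\Gamma<\Gamma'$ if moreover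 $l(\Gamma)<l(\Gamma')$. In that case $p_{\Gamma',\Gamma}:\Gamma'\to\Gamma$ is the composite of the $p$-morphisms. For $f:\Gamma\to ft^i(\Gamma')$, $l(\Gamma')\ge i$, define $f^*(\Gamma',0)=\Gamma$, $q(f,\Gamma',0)=f$, $f^*(\Gamma',i+1)=q(f,ft(\Gamma'),i)^*(\Gamma')$, $q(f,\Gamma',i+1)=q(q(f,ft(\Gamma'),i),\Gamma')$. If $\Gamma'\ge\Delta$ and $f:\Gamma\to\Delta$, write $f^*(\Gamma')$, $q(f,\Gamma')$ for these with $i=l(\Gamma')-l(\Delta)$. A morphism $a:\Gamma'\to\Gamma''$ of objects over $\Delta$ is over $\Delta$ if $a\circ p_{\Gamma'',\Delta}=p_{\Gamma',\Delta}$; then $f^*(a):f^*(\Gamma')\to f^*(\Gamma'')$ is the unique morphism over $\Gamma$ with $f^*(a)\circ q(f,\Gamma'')=q(f,\Gamma')\circ a$. $\widetilde{Ob}(CC)$ is the set of morphisms $s:ft(X)\to X$ with $l(X)>0$ and $s\circ p_X=Id_{ft(X)}$; for such $s$ put $\partial(s)=X$. Operations: $T(\Gamma,\Gamma')=p_\Gamma^*(\Gamma')\in Ob$ for $\Gamma,\Gamma'\in Ob$ with $l(\Gamma)>0$, $\Gamma'>ft(\Gamma)$; $\widetilde T(\Gamma,s)=p_\Gamma^*(s)\in\widetilde{Ob}$ for $\Gamma\in Ob$, $s\in\widetilde{Ob}$ with $l(\Gamma)>0$, $\partial(s)>ft(\Gamma)$; $S(r,\Gamma)=r^*(\Gamma)\in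 Ob$ for $r\in\widetilde{Ob}$, $\Gamma\in Ob$ with $\Gamma>\partial(r)$; $\widetilde S(r,s)=r^*(s)\in\widetilde{Ob}$ for $r,s\in\widetilde{Ob}$ with $\partial(s)>\partial(r)$; $\delta(\Gamma)=s_{Id_\Gamma}\in\widetilde{Ob}$ for $\Gamma\in Ob$ with $l(\Gamma)>0$. $Jf$-relative monads. $stn(n)=\{0,\dots,n-1\}$, $Fun(X,Y)$ is the set of functions $X\to Y$, $F(m,n)=Fun(stn(m),stn(n))$. A $Jf$-relative monad $RR$ consists of sets $RR(n)$ ($n\in\mathbb N$), functions $\eta(n):stn(n)\to RR(n)$, and for each $f\in RR(m,n):=Fun(stn(m),RR(n))$ a function $\rho(f):RR(m)\to RR(n)$, such that $\rho(\eta(n))=Id_{RR(n)}$, $\eta(m)\circ\rho(f)=f$ and $\rho(f)\circ\rho(g)=\rho(f\circ\rho(g))$ for $f\in RR(l,m)$, $g\in RR(m,n)$. Elements $f\in RR(m,n)$ are written as sequences $(f(0),\dots,f(m-1))$. The Kleisli category has objects $\mathbb N$, morphisms $m\to n$ the elements of $RR(m,n)$ (tagged by $m,n$), composition $f\circ_T g=f\circ\rho(g)$ and identities $\eta(m)$. For $f\in F(m,n)$ put $L(f)=f\circ\eta(n)\in RR(m,n)$ and, for $x\in RR(m)$, $f(x):=\rho(L(f))(x)$. Put $x_i^n=\eta(n)(i)\in RR(n)$. $\partial^i_n:stn(n)\to stn(n+1)$ ($0\le i\le n$) is the increasing injection omitting the value $i$; $\iota_n^i:stn(n)\to stn(n+i)$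 is $j\mapsto j$. For $f\in RR(n,m)$, $qq(f)=(\iota_m^1(f(0)),\dots,\iota_m^1(f(n-1)),x_m^{m+1})\in RR(n+1,m+1)$, and $qq^i$ is its $i$-fold iterate. A left $RR$-module $LM$ with values in sets is a covariant functor from the Kleisli category to sets; its value at $n$ is written $LM(n)$. For $f\in RR(n,m)$ and $E\in LM(n)$ write $f(E)\in LM(m)$ for its action; for $f\in F(n,m)$ write $f(E)=L(f)(E)$. For $n>m$ define $\theta_{m,n}:RR(m)\times RR(n)\to RR(n-1)$ by $\theta_{m,n}(r,s)=\rho(qq^{n-m-1}(x_0^m,\dots,x_{m-1}^m,r))(s)$ and $\theta_{m,n}:RR(m)\times LM(n)\to LM(n-1)$ by $\theta_{m,n}(r,E)=(qq^{n-m-1}(x_0^m,\dots,x_{m-1}^m,r))(E)$; which one is meant is clear from the arguments. The C-system $C(RR,LM)$. $Ob_n(RR,LM)=LM(0)\times\dots\times LM(n-1)$; objects are pairs $(n,\Gamma)$ with $\Gamma=(T_0,\dots,T_{n-1})\in Ob_n(RR,LM)$. Morphisms $(m,\Gamma)\to(n,\Gamma')$ are elements of $RR(n,m)$ (tagged by domain and codomain); the composite of $f:(l,\Gamma)\to(m,\Gamma')$ and $g:(m,\Gamma')\to(n,\Gamma'')$ is $g\circ_T f$; identities are $\eta(n)$. $l(n,\Gamma)=n$, $pt=(0,())$, $ft(n+1,(T_0,\dots,T_n))=(n,(T_0,\dots,T_{n-1}))$, $p_{(n+1,\Gamma)}=(x_0^{n+1},\dots,x_{n-1}^{n+1})$.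 For $X=(m,(T_0,\dots,T_{m-1}))$, $Y=(n+1,(T'_0,\dots,T'_n))$ and $f:X\to ft(Y)$: $f^*(Y)=(m+1,(T_0,\dots,T_{m-1},f(T'_n)))$ and $q(f,Y)=qq(f)$. The bijection $mb:\widetilde{Ob}(C(RR,LM))\to\coprod_n Ob_{n+1}(RR,LM)\times RR(n)$ sends $s:ft(X)\to X$, $X=(n+1,\Gamma)$, to $(n,(\Gamma,s(n)))$; its inverse sends $(n,(\Gamma,o))$ to the morphism $(x_0^n,\dots,x_{n-1}^n,o)$ from $ft(n+1,\Gamma)$ to $(n+1,\Gamma)$. *)

(* Defs.v *)
From mathcomp Require Import all_boot.
From mathcomp Require Import boolp.

Set Implicit Arguments.
Unset Strict Implicit.
Unset Printing Implicit Defensive.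

Lemma existT_inj (A : Type) (P : A -> Type) (a : A) (x y : P a) :
  existT P a x = existT P a y -> x = y.
Proof.
move=> e; have := projT2_eq e.
by rewrite (Prop_irrelevance (projT1_eq e) erefl).
Qed.

Record category := Category {
  ob :> Type;
  hom : ob -> ob -> Type;
  idm : forall X, hom X X;
  cmp : forall X Y Z, hom X Y -> hom Y Z -> hom X Z;
  cmp1m : forall X Y (f : hom X Y), cmp (idm X) f = f;
  cmpm1 : forall X Y (f : hom X Y), cmp f (idm Y) = f;
  cmpA : forall X Y Z W (f : hom X Y) (g : hom Y Z) (h : hom Z W),
    cmp f (cmp g h) = cmp (cmp f g) h }.

Arguments hom {c} _ _ : rename.
Arguments idm {c} X : rename.
Arguments cmp {c X Y Z} f g : rename.

(* Composition is in diagrammatic order. *)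
Notation "f \o> g" := (cmp f g) (at level 50, left associativity).

Record set_functor (K : category) := SetFunctor {
  fob :> K -> Type;
  fmap : forall X Y : K, hom X Y -> fob X -> fob Y;
  fmap1 : forall (X : K) (x : fob X), fmap (idm X) x = x;
  fmapM : forall (X Y Z : K) (f : hom X Y) (g : hom Y Z) (x : fob X),
    fmap (f \o> g) x = fmap g (fmap f x) }.

Arguments fmap {K} s {X Y} f x : rename.

(* A morphism tagged by its domain and codomain.  Equality of [mor f] and
   [mor g] is equality of morphisms whose endpoints agree only propositionally;
   [castd] and [castc] transport a domain, resp. a codomain. *)
Definition mor (K : category) (X Y : K) (f : hom X Y) :
    {X : K & {Y : K & hom X Y}} :=
  existT _ X (existT _ Y f).

Definition castd (K : category) (X X' Y : K) (e : X = X') (f : hom X Y) :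
  hom X' Y := eq_rect X (fun X0 => hom X0 Y) f X' e.

Definition castc (K : category) (X Y Y' : K) (e : Y = Y') (f : hom X Y) :
  hom X Y' := eq_rect Y (fun Y0 => hom X Y0) f Y' e.

Section CategoryFacts.
Context (K : category).
Implicit Types X Y Z W : K.

Lemma mor_inj X Y (f g : hom X Y) : mor f = mor g -> f = g.
Proof. by move=> e; exact: existT_inj (existT_inj e). Qed.

Lemma mor_castd X X' Y (e : X = X') (f : hom X Y) : mor (castd e f) = mor f.
Proof. by case: X' / e. Qed.

Lemma mor_castc X Y Y' (e : Y = Y') (f : hom X Y) : mor (castc e f) = mor f.
Proof. by case: Y' / e. Qed.

Lemma mor_dom X Y X' Y' (f : hom X Y) (f' : hom X' Y') :
  mor f = mor f' -> X = X'.
Proof. by move/(congr1 (fun m => projT1 m)). Qed.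

Lemma mor_cod X Y X' Y' (f : hom X Y) (f' : hom X' Y') :
  mor f = mor f' -> Y = Y'.
Proof. by move/(congr1 (fun m => projT1 (projT2 m))). Qed.

Lemma mor_cmp X Y Z X' Y' Z' (f : hom X Y) (g : hom Y Z)
    (f' : hom X' Y') (g' : hom Y' Z') :
  mor f = mor f' -> mor g = mor g' -> mor (f \o> g) = mor (f' \o> g').
Proof.
move=> ef eg.
have eX := mor_dom ef; have eY := mor_cod ef; have eZ := mor_cod eg.
by subst X' Y' Z'; rewrite (mor_inj ef) (mor_inj eg).
Qed.

End CategoryFacts.

(* Notation: [pull1 hX f] is f^*(X), [q1 hX f] is q(f, X), and below
   [sec hX f] is s_f. *)
Record c0system := C0System {
  c0cat :> category;
  len : c0cat -> nat;
  pt : c0cat;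
  ft : c0cat -> c0cat;
  pr : forall X : c0cat, hom X (ft X);
  pull1 : forall X Y : c0cat, 0 < len X -> hom Y (ft X) -> c0cat;
  q1 : forall (X Y : c0cat) (hX : 0 < len X) (f : hom Y (ft X)),
    hom (pull1 hX f) X;
  len_eq0 : forall X, len X = 0 <-> X = pt;
  len_ft : forall X, 0 < len X -> len (ft X) = (len X).-1;
  ft_pt : ft pt = pt;
  pt_final : forall X, exists! f : hom X pt, True;
  len_pull1 : forall X Y (hX : 0 < len X) (f : hom Y (ft X)),
    0 < len (pull1 hX f);
  ft_pull1 : forall X Y (hX : 0 < len X) (f : hom Y (ft X)),
    ft (pull1 hX f) = Y;
  q1_pr : forall X Y (hX : 0 < len X) (f : hom Y (ft X)),
    q1 hX f \o> pr X = castc (ft_pull1 hX f) (pr (pull1 hX f)) \o> f;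
  pull1_id : forall X (hX : 0 < len X), pull1 hX (idm (ft X)) = X;
  q1_id : forall X (hX : 0 < len X), mor (q1 hX (idm (ft X))) = mor (idm X);
  pull1_cmp : forall X Y Z (hX : 0 < len X) (f : hom Y (ft X)) (g : hom Z Y),
    pull1 hX (g \o> f) =
      pull1 (len_pull1 hX f) (castc (esym (ft_pull1 hX f)) g);
  q1_cmp : forall X Y Z (hX : 0 < len X) (f : hom Y (ft X)) (g : hom Z Y),
    mor (q1 hX (g \o> f)) =
      mor (q1 (len_pull1 hX f) (castc (esym (ft_pull1 hX f)) g) \o> q1 hX f) }.

Arguments pr {c} X : rename.
Arguments pull1 {c X Y} hX f : rename.
Arguments q1 {c X Y} hX f : rename.
Arguments len_pull1 {c X Y} hX f : rename.
Arguments ft_pull1 {c X Y} hX f : rename.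

Record csystem := CSystem {
  c0sys :> c0system;
  sec : forall (X Y : c0sys) (hX : 0 < len X) (f : hom Y X),
    hom Y (pull1 hX (f \o> pr X));
  sec_pr : forall (X Y : c0sys) (hX : 0 < len X) (f : hom Y X),
    sec hX f \o> castc (ft_pull1 hX (f \o> pr X)) (pr _) = idm Y;
  sec_q1 : forall (X Y : c0sys) (hX : 0 < len X) (f : hom Y X),
    sec hX f \o> q1 hX (f \o> pr X) = f;
  sec_nat : forall (Z W Y : c0sys) (hZ : 0 < len Z) (g : hom W (ft Z))
      (f : hom Y (pull1 hZ g)),
    mor (sec (len_pull1 hZ g) f) = mor (sec hZ (f \o> q1 hZ g)) }.

Arguments sec {c X Y} hX f : rename.

Section COps.
Context (C : csystem).
Implicit Types X Y Z D : C.

Lemma q1_eq X (h h' : 0 < len X) Y Y' (f : hom Y (ft X)) (f' : hom Y' (ft X)) :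
  mor f = mor f' -> mor (q1 h f) = mor (q1 h' f').
Proof.
move=> e; have eY := mor_dom e; subst Y'.
by rewrite (mor_inj e) (bool_irrelevance h h').
Qed.

Lemma pull1_pb X Y (hX : 0 < len X) (f : hom Y (ft X)) Z
    (u : hom Z Y) (v : hom Z X) : u \o> f = v \o> pr X ->
  exists2 w : hom Z (pull1 hX f),
    w \o> castc (ft_pull1 hX f) (pr _) = u /\ w \o> q1 hX f = v &
    forall w' : hom Z (pull1 hX f),
      w' \o> castc (ft_pull1 hX f) (pr _) = u -> w' \o> q1 hX f = v -> w' = w.
Proof.
move=> e.
have ex : exists w : hom Z (pull1 hX f),
    w \o> castc (ft_pull1 hX f) (pr _) = u /\ w \o> q1 hX f = v.
  pose u' := castc (esym (ft_pull1 hX f)) u.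
  have eq : mor (q1 hX (v \o> pr X)) =
            mor (q1 (len_pull1 hX f) u' \o> q1 hX f).
    by rewrite -e q1_cmp.
  have ob_e := mor_dom eq.
  pose w0 := castc ob_e (sec hX v).
  exists (w0 \o> q1 (len_pull1 hX f) u'); split; apply: mor_inj.
    transitivity (mor (w0 \o> (q1 (len_pull1 hX f) u' \o> pr _))).
      rewrite cmpA; apply: mor_cmp => //; exact: mor_castc.
    rewrite q1_pr cmpA -[in RHS](cmp1m u); apply: mor_cmp; last exact: mor_castc.
    rewrite -(sec_pr hX v); apply: mor_cmp; first exact: mor_castc.
    by rewrite !mor_castc -ob_e.
  rewrite -cmpA -[in RHS](sec_q1 hX v); apply: mor_cmp; first exact: mor_castc.
  by rewrite eq.
have uniq_w (w w' : hom Z (pull1 hX f)) :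
    w \o> castc (ft_pull1 hX f) (pr _) = w' \o> castc (ft_pull1 hX f) (pr _) ->
    w \o> q1 hX f = w' \o> q1 hX f -> w = w'.
  move=> ep eq.
  have es : mor (sec (len_pull1 hX f) w) = mor (sec (len_pull1 hX f) w').
    by rewrite !sec_nat eq.
  apply: mor_inj.
  rewrite -(sec_q1 (len_pull1 hX f) w) -(sec_q1 (len_pull1 hX f) w').
  apply: mor_cmp => //; apply: q1_eq.
  transitivity (mor (w \o> castc (ft_pull1 hX f) (pr _))).
    by apply: mor_cmp => //; rewrite mor_castc.
  rewrite ep; apply: mor_cmp => //; exact: mor_castc.
have [w [wu wv]] := ex.
exists w => // w' wu' wv'; apply: uniq_w; first by rewrite wu wu'.
by rewrite wv wv'.
Qed.

Fixpoint ftn (i : nat) X : C := if i is j.+1 then ftn j (ft X) else X.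

Fixpoint prn (i : nat) X : hom X (ftn i X) :=
  match i with
  | 0 => idm X
  | j.+1 => pr X \o> prn j (ft X)
  end.

Lemma len_gt0 i X : i.+1 <= len X -> 0 < len X.
Proof. exact: leq_trans. Qed.

Lemma leq_len_ft i X : i.+1 <= len X -> i <= len (ft X).
Proof. by move=> h; rewrite len_ft ?(len_gt0 h) // -ltnS prednK ?(len_gt0 h). Qed.

(* The object f^*(X, i) together with the morphism q(f, X, i). *)
Fixpoint pullqn (i : nat) X :
    i <= len X -> forall Y, hom Y (ftn i X) -> {W : C & hom W X} :=
  match i with
  | 0 => fun _ Y f => existT _ Y f
  | j.+1 => fun h Y f =>
      let g := projT2 (pullqn (leq_len_ft h) f) in
      existT _ (pull1 (len_gt0 h) g) (q1 (len_gt0 h) g)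
  end.

(* [over D X] reads "X is over D", i.e. D <= X. *)
Definition over D X : Prop :=
  len D <= len X /\ D = ftn (len X - len D) X.

Definition sover D X : Prop := over D X /\ len D < len X.

Definition prover D X (h : over D X) : hom X D :=
  castc (esym h.2) (prn (len X - len D) X).

Definition pullq D X (h : over D X) Y (f : hom Y D) : {W : C & hom W X} :=
  pullqn (leq_subr (len D) (len X)) (castc h.2 f).

Definition pull D X (h : over D X) Y (f : hom Y D) : C := projT1 (pullq h f).

Definition q D X (h : over D X) Y (f : hom Y D) : hom (pull h f) X :=
  projT2 (pullq h f).

Definition morover D X X' (h : over D X) (h' : over D X') (a : hom X X') :
  Prop := a \o> prover h' = prover h.

Lemma pullqn_len i X (h : i <= len X) Y (f : hom Y (ftn i X)) :
  len (projT1 (pullqn h f)) = i + len Y.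
Proof.
elim: i X h Y f => [//|i IH] X h Y f /=.
set g := projT2 _.
rewrite addSn -(IH (ft X) (leq_len_ft h) Y f).
have := len_ft (len_pull1 (len_gt0 h) g).
by rewrite ft_pull1 => ->; rewrite prednK // len_pull1.
Qed.

Lemma pullqn_ftn i X (h : i <= len X) Y (f : hom Y (ftn i X)) :
  ftn i (projT1 (pullqn h f)) = Y.
Proof.
elim: i X h Y f => [//|i IH] X h Y f /=.
by rewrite ft_pull1 IH.
Qed.

Lemma prn_eq i i' X X' : i = i' -> X = X' -> mor (prn i X) = mor (prn i' X').
Proof. by move=> -> ->. Qed.

Lemma pullqn_pb i X (h : i <= len X) Y (f : hom Y (ftn i X)) :
  let g := projT2 (pullqn h f) in
  let p := castc (pullqn_ftn h f) (prn i (projT1 (pullqn h f))) in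
  g \o> prn i X = p \o> f /\
  forall Z (u : hom Z Y) (v : hom Z X), u \o> f = v \o> prn i X ->
    exists! w : hom Z (projT1 (pullqn h f)), w \o> p = u /\ w \o> g = v.
Proof.
elim: i X h Y f => [|i IH] X h Y f.
  move=> g p; have ep : p = idm Y by apply: mor_inj; rewrite mor_castc.
  split; first by rewrite ep cmp1m cmpm1.
  move=> Z u v e; exists u; split.
    by rewrite ep cmpm1 /g /= e cmpm1.
  by move=> w' []; rewrite ep cmpm1.
move=> g p.
pose g0 := projT2 (pullqn (leq_len_ft h) f).
pose p0 := castc (pullqn_ftn (leq_len_ft h) f)
             (prn i (projT1 (pullqn (leq_len_ft h) f))).
have [sq0 pb0] : g0 \o> prn i (ft X) = p0 \o> f /\
  forall Z (u : hom Z Y) (v : hom Z (ft X)), u \o> f = v \o> prn i (ft X) ->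
    exists! w, w \o> p0 = u /\ w \o> g0 = v := IH _ (leq_len_ft h) Y f.
have ep : p = castc (ft_pull1 (len_gt0 h) g0) (pr _) \o> p0.
  apply: mor_inj; rewrite mor_castc /=; apply: mor_cmp.
    by rewrite mor_castc.
  rewrite mor_castc; apply: prn_eq => //; exact: ft_pull1.
split.
  rewrite /g /= cmpA q1_pr ep -!cmpA; congr (_ \o> _).
  exact: sq0.
move=> Z u v /=; rewrite cmpA => e.
have [u0 [[u0p u0g] u0u]] := pb0 Z u (v \o> pr X) e.
have [w [wu wv] wuniq] := pull1_pb (len_gt0 h) u0g.
exists w; split.
  split; last exact: wv.
  by rewrite ep cmpA wu u0p.
move=> w' [w'p w'g]; apply/esym/wuniq => //.
apply/esym/u0u; split; first by rewrite -cmpA -ep.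
by rewrite -cmpA -q1_pr cmpA; congr (_ \o> _).
Qed.

Lemma over_pull D X (h : over D X) Y (f : hom Y D) : over Y (pull h f).
Proof.
rewrite /over /pull /pullq pullqn_len leq_addl; split=> //.
by rewrite addnK pullqn_ftn.
Qed.

Lemma prover_pull D X (h : over D X) Y (f : hom Y D) :
  prover (over_pull h f) =
  castc (pullqn_ftn (leq_subr (len D) (len X)) (castc h.2 f)) (prn _ _).
Proof.
apply: mor_inj; rewrite !mor_castc; apply: prn_eq => //.
by rewrite /pull /pullq pullqn_len addnK.
Qed.

Lemma pull_pb D X (h : over D X) Y (f : hom Y D) :
  q h f \o> prover h = prover (over_pull h f) \o> f /\
  forall Z (u : hom Z Y) (v : hom Z X), u \o> f = v \o> prover h ->
    exists! w : hom Z (pull h f),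
      w \o> prover (over_pull h f) = u /\ w \o> q h f = v.
Proof.
rewrite prover_pull.
have [sq pb] := pullqn_pb (leq_subr (len D) (len X)) (castc h.2 f).
have cst A (a : hom A X) :
    mor (a \o> prover h) = mor (a \o> prn (len X - len D) X).
  by apply: mor_cmp => //; rewrite mor_castc.
have cf A (a : hom A Y) : mor (a \o> f) = mor (a \o> castc h.2 f).
  by apply: mor_cmp => //; rewrite mor_castc.
split; first by apply: mor_inj; rewrite cst cf; congr mor.
by move=> Z u v e; apply: pb; apply: mor_inj; rewrite -cst -cf e.
Qed.

Lemma pullm_subproof D X X' (h : over D X) (h' : over D X') (a : hom X X')
    (ha : morover h h' a) Y (f : hom Y D) :
  exists! b : hom (pull h f) (pull h' f),
    morover (over_pull h f) (over_pull h' f) b /\ b \o> q h' f = q h f \o> a.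
Proof.
have [sq _] := pull_pb h f; have [_ pb] := pull_pb h' f.
by apply: pb; rewrite -cmpA ha.
Qed.

Definition pullm D X X' (h : over D X) (h' : over D X') (a : hom X X')
    (ha : morover h h' a) Y (f : hom Y D) : hom (pull h f) (pull h' f) :=
  projT1 (cid (pullm_subproof ha f)).

Lemma pullmP D X X' (h : over D X) (h' : over D X') (a : hom X X')
    (ha : morover h h' a) Y (f : hom Y D) :
  morover (over_pull h f) (over_pull h' f) (pullm ha f) /\
  pullm ha f \o> q h' f = q h f \o> a.
Proof. by rewrite /pullm; case: cid => b [[]]. Qed.

(* The set Ob~ of a C-system. *)
Record obt := Obt {
  bd : C;
  bd_gt0 : 0 < len bd;
  obs : hom (ft bd) bd;
  obsK : obs \o> pr bd = idm (ft bd) }.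

Lemma sover_gt0 D X : sover D X -> 0 < len X.
Proof. by case=> _; apply: leq_ltn_trans. Qed.

Lemma sover_sub D X : sover D X -> len X - len D = (len (ft X) - len D).+1.
Proof.
move=> h; have X0 := sover_gt0 h; case: h => _.
by rewrite len_ft //; case: (len X) X0 => // n _ lt_Dn; rewrite subSn.
Qed.

Lemma over_ft D X : sover D X -> over D (ft X).
Proof.
move=> h; have X0 := sover_gt0 h; have es := sover_sub h.
case: h => -[_ eD] lt_DX; split; last by rewrite [LHS]eD es.
by rewrite len_ft // -ltnS prednK.
Qed.

Lemma morover_obs D (s : obt) (h : sover D (bd s)) :
  morover (over_ft h) h.1 (obs s).
Proof.
apply: mor_inj; rewrite /prover.
transitivity (mor (obs s \o> (pr (bd s) \o> prn (len (ft (bd s)) - len D) (ft (bd s))))).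
  apply: mor_cmp => //; rewrite mor_castc.
  exact: (prn_eq (sover_sub h) erefl).
by rewrite cmpA obsK cmp1m mor_castc.
Qed.

Lemma pullqn_irr i X (h h' : i <= len X) Y (f f' : hom Y (ftn i X)) :
  mor f = mor f' -> pullqn h f = pullqn h' f'.
Proof. by move=> /mor_inj ->; rewrite (bool_irrelevance h h'). Qed.

Lemma pullqn_succ i j X (h : i <= len X) (h' : j <= len (ft X)) (X0 : 0 < len X)
    Y (f : hom Y (ftn i X)) (f' : hom Y (ftn j (ft X))) :
  i = j.+1 -> mor f = mor f' ->
  pullqn h f = existT _ (pull1 X0 (projT2 (pullqn h' f')))
                        (q1 X0 (projT2 (pullqn h' f'))).
Proof.
move=> eij; move: h f; rewrite eij => h f ef /=.
rewrite (pullqn_irr (leq_len_ft h) h' ef).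
by rewrite (bool_irrelevance (len_gt0 h) X0).
Qed.

Lemma pull_sover D X (h : sover D X) Y (f : hom Y D) :
  pullq h.1 f = existT _ (pull1 (sover_gt0 h) (q (over_ft h) f))
                         (q1 (sover_gt0 h) (q (over_ft h) f)).
Proof.
apply: pullqn_succ; first exact: sover_sub.
by rewrite !mor_castc.
Qed.

Lemma ft_pull D X (h : sover D X) Y (f : hom Y D) :
  pull (over_ft h) f = ft (pull h.1 f).
Proof. by rewrite [in RHS]/pull pull_sover /= ft_pull1. Qed.

Lemma len_pull_gt0 D X (h : sover D X) Y (f : hom Y D) : 0 < len (pull h.1 f).
Proof. by rewrite /pull pull_sover /= len_pull1. Qed.

Lemma q_pr D X (h : sover D X) Y (f : hom Y D) :
  q h.1 f \o> pr X =
  castc (esym (ft_pull h f)) (pr (pull h.1 f)) \o> q (over_ft h) f.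
Proof.
apply: mor_inj; rewrite /q.
have E : mor (projT2 (pullq h.1 f) \o> pr X) =
         mor (pr (pull h.1 f) \o> castd (ft_pull h f) (q (over_ft h) f)).
  rewrite /pull; move: (ft_pull h f); rewrite /pull pull_sover /= => e.
  rewrite q1_pr; apply: mor_cmp; first exact: mor_castc.
  by rewrite mor_castd.
rewrite E; apply: mor_cmp; first by rewrite mor_castc.
exact: mor_castd.
Qed.

Lemma prover_ft D X (h : sover D X) :
  prover h.1 = pr X \o> prover (over_ft h).
Proof.
apply: mor_inj; rewrite mor_castc.
transitivity (mor (pr X \o> prn (len (ft X) - len D) (ft X))).
  exact: (prn_eq (sover_sub h) erefl).
by apply: mor_cmp => //; rewrite mor_castc.
Qed.

Lemma pulls_subproof D (s : obt) (h : sover D (bd s)) Y (f : hom Y D) :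
  castd (ft_pull h f) (pullm (morover_obs h) f) \o> pr (pull h.1 f) =
  idm (ft (pull h.1 f)).
Proof.
pose b := pullm (morover_obs h) f.
have [bover bq] := pullmP (morover_obs h) f.
pose c := castc (esym (ft_pull h f)) (pr (pull h.1 f)).
have bc : b \o> c = idm _.
  have [sq pb] := pull_pb (over_ft h) f.
  have [w [_ wuniq]] := pb _ (prover (over_pull (over_ft h) f))
                             (q (over_ft h) f) (esym sq).
  have idw : w = idm _ by apply: wuniq; rewrite !cmp1m.
  rewrite -idw; apply/esym/wuniq; split; last first.
    by rewrite -cmpA -q_pr cmpA bq -cmpA obsK cmpm1.
  rewrite -cmpA -[RHS]bover; congr (_ \o> _).
  have so : sover Y (pull h.1 f).
    split; first exact: over_pull.
    have [le_Y _] := over_pull (over_ft h) f.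
    apply: leq_ltn_trans le_Y _.
    by rewrite ft_pull len_ft ?len_pull_gt0 // ltn_predL len_pull_gt0.
  rewrite (Prop_irrelevance (over_pull h.1 f) so.1) prover_ft.
  apply: mor_inj; apply: mor_cmp; first exact: mor_castc.
  by rewrite !mor_castc; apply: prn_eq; rewrite (ft_pull h f).
apply: mor_inj.
transitivity (mor (b \o> c)); last by rewrite bc ft_pull.
by apply: mor_cmp; rewrite ?mor_castd ?mor_castc.
Qed.

Definition pulls D (s : obt) (h : sover D (bd s)) Y (f : hom Y D) : obt :=
  Obt (len_pull_gt0 h f) (pulls_subproof h f).

(* Each partial operation is given by its domain and a function of a proof
   that the arguments lie in that domain; Tt and St stand for T~ and S~. *)

Definition T_dom (G G' : C) : Prop := 0 < len G /\ sover (ft G) G'.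

Definition T_op (G G' : C) (h : T_dom G G') : C := pull h.2.1 (pr G).

Definition Tt_dom (G : C) (s : obt) : Prop := 0 < len G /\ sover (ft G) (bd s).

Definition Tt_op (G : C) (s : obt) (h : Tt_dom G s) : obt := pulls h.2 (pr G).

Definition S_dom (r : obt) (G : C) : Prop := sover (bd r) G.

Definition S_op (r : obt) (G : C) (h : S_dom r G) : C := pull h.1 (obs r).

Definition St_dom (r s : obt) : Prop := sover (bd r) (bd s).

Definition St_op (r s : obt) (h : St_dom r s) : obt := pulls h (obs r).

Definition delta_dom (G : C) : Prop := 0 < len G.

Lemma delta_subproof (G : C) (h : delta_dom G) :
  castd (esym (ft_pull1 h (idm G \o> pr G))) (sec h (idm G)) \o> pr _ =
  idm (ft (pull1 h (idm G \o> pr G))).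
Proof.
apply: mor_inj.
transitivity (mor (idm G)); last by rewrite (ft_pull1 h (idm G \o> pr G)).
rewrite -[RHS](congr1 (@mor _ _ _) (sec_pr h (idm G))).
by apply: mor_cmp; rewrite ?mor_castd ?mor_castc.
Qed.

Definition delta_op (G : C) (h : delta_dom G) : obt :=
  Obt (len_pull1 h (idm G \o> pr G)) (delta_subproof h).

End COps.

Record rel_monad := RelMonad {
  rm :> nat -> Type;
  eta : forall n, 'I_n -> rm n;
  rho : forall m n, ('I_m -> rm n) -> rm m -> rm n;
  rho_eta : forall n (x : rm n), rho (@eta n) x = x;
  eta_rho : forall m n (f : 'I_m -> rm n) (i : 'I_m), rho f (eta i) = f i;
  rho_rho : forall l m n (f : 'I_l -> rm m) (g : 'I_m -> rm n) (x : rm l),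
    rho g (rho f x) = rho (rho g \o f) x }.

Arguments eta {r n} i : rename.
Arguments rho {r m n} f x : rename.

Section Kleisli.
Context (RR : rel_monad).

Fact kleisli1m (m n : nat) (f : 'I_m -> RR n) : rho f \o eta = f.
Proof. by apply: funext => i; exact: eta_rho. Qed.

Fact kleislim1 (m n : nat) (f : 'I_m -> RR n) : rho eta \o f = f.
Proof. by apply: funext => i /=; exact: rho_eta. Qed.

Fact kleisliA (l m n k : nat) (f : 'I_l -> RR m) (g : 'I_m -> RR n)
  (h : 'I_n -> RR k) : rho (rho h \o g) \o f = rho h \o (rho g \o f).
Proof. by apply: funext => i /=; rewrite rho_rho. Qed.

Definition kleisli : category :=
  @Category nat (fun m n => 'I_m -> RR n) (fun n => @eta RR n)
    (fun l m n f g => rho g \o f) kleisli1m kleislim1 kleisliA.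

(* [Lmor f] is L(f), and [ren f x], [renm f E] are f(x) and f(E) for a map f
   of finite sets. *)
Definition Lmor m n (f : 'I_m -> 'I_n) : 'I_m -> RR n := eta \o f.

Definition ren m n (f : 'I_m -> 'I_n) (x : RR m) : RR n := rho (Lmor f) x.

End Kleisli.

Arguments Lmor {RR m n} f i.

Definition lmodule (RR : rel_monad) := set_functor (kleisli RR).

Definition lmod_val (RR : rel_monad) (LM : lmodule RR) (n : nat) : Type :=
  fob LM n.
Coercion lmod_val : lmodule >-> Funclass.

Definition act (RR : rel_monad) (LM : lmodule RR) m n (f : 'I_m -> RR n)
  (E : LM m) : LM n := @fmap _ LM m n f E.

Definition renm (RR : rel_monad) (LM : lmodule RR) m n (f : 'I_m -> 'I_n)
  (E : LM m) : LM n := act (Lmor f) E.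

Lemma act1 (RR : rel_monad) (LM : lmodule RR) m (E : LM m) : act eta E = E.
Proof. exact: (@fmap1 _ LM m). Qed.

Lemma actM (RR : rel_monad) (LM : lmodule RR) l m n (f : 'I_l -> RR m)
  (g : 'I_m -> RR n) (E : LM l) : act (rho g \o f) E = act g (act f E).
Proof. exact: (@fmapM _ LM l m n). Qed.

(* The increasing injection omitting the value i. *)
Definition face i n (h : i < n.+1) : 'I_n -> 'I_n.+1 := lift (Ordinal h).

Definition iota1 n : 'I_n -> 'I_n.+1 := widen_ord (leqnSn n).

(* The sequence (f(0), ..., f(n-1), a). *)
Definition snoc (A : Type) n (f : 'I_n -> A) (a : A) : 'I_n.+1 -> A :=
  fun j => oapp f a (unlift ord_max j).

Lemma snoc_max (A : Type) n (f : 'I_n -> A) (a : A) (i : 'I_n.+1) :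
  i = n :> nat -> snoc f a i = a.
Proof.
move=> e; have -> : i = ord_max by apply: val_inj.
by rewrite /snoc unlift_none.
Qed.

Lemma snoc_lt (A : Type) n (f : 'I_n -> A) (a : A) (i : 'I_n.+1) (j : 'I_n) :
  i = j :> nat -> snoc f a i = f j.
Proof.
move=> e; rewrite /snoc; suff -> : i = lift ord_max j by rewrite liftK.
by apply: val_inj; rewrite /= /bump leqNgt ltn_ord.
Qed.

Definition qq (RR : rel_monad) n m (f : 'I_n -> RR m) : 'I_n.+1 -> RR m.+1 :=
  snoc (fun j => ren (@iota1 m) (f j)) (eta ord_max).

Fixpoint qqn (RR : rel_monad) i n m (f : 'I_n -> RR m) :
    'I_(i + n) -> RR (i + m) :=
  match i return 'I_(i + n) -> RR (i + m) with
  | 0 => f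
  | j.+1 => qq (@qqn RR j n m f)
  end.

Arguments qqn {RR} i {n m} f.

Lemma theta_srcE m n : m < n -> n = (n - m.+1) + m.+1.
Proof. by move=> h; rewrite subnK. Qed.

Lemma theta_tgtE m n : m < n -> (n - m.+1) + m = n.-1.
Proof. by case: n => // n h; rewrite subSS subnK. Qed.

(* qq^{n-m-1}(x_0, ..., x_{m-1}, r), transported along the two identities of
   natural numbers above. *)
Definition theta_mor (RR : rel_monad) m n (h : m < n) (r : RR m) :
    'I_n -> RR n.-1 :=
  fun i => eq_rect _ RR
    (qqn (n - m.+1) (snoc eta r) (cast_ord (theta_srcE h) i)) _ (theta_tgtE h).

Definition theta (RR : rel_monad) m n (h : m < n) (r : RR m) (s : RR n) :
  RR n.-1 := rho (theta_mor h r) s.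

Definition thetam (RR : rel_monad) (LM : lmodule RR) m n (h : m < n) (r : RR m)
  (E : LM n) : LM n.-1 := act (theta_mor h r) E.

Section CRRLM.
Context (RR : rel_monad) (LM : lmodule RR).

Definition obn (n : nat) : Type := forall i : 'I_n, LM i.

Definition crob : Type := {n : nat & obn n}.

Definition cr_cat : category :=
  @Category crob (fun X Y => 'I_(projT1 Y) -> RR (projT1 X))
    (fun X => @eta RR (projT1 X)) (fun X Y Z f g => rho f \o g)
    (fun X Y f => kleislim1 f) (fun X Y f => kleisli1m f)
    (fun X Y Z W f g h => esym (kleisliA h g f)).

Definition cob (n : nat) (G : obn n) : cr_cat := existT obn n G.

Definition cr_pt : cr_cat :=
  existT obn 0 (fun i : 'I_0 => False_rect _ (notF (ltn_ord i))).

(* The first n.-1 terms of a sequence; the empty sequence if n = 0. *)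
Definition obn_ft n (G : obn n) : obn n.-1 :=
  fun i => G (widen_ord (leq_pred n) i).

Definition cr_ft (X : cr_cat) : cr_cat := existT obn _ (obn_ft (projT2 X)).

Definition cr_pr (X : cr_cat) : hom X (cr_ft X) :=
  fun i => eta (widen_ord (leq_pred (projT1 X)) i).

Arguments cr_pr X : clear implicits.

Lemma leq_ltS n j : n <= j -> j < n.+1 -> n = j.
Proof. by move=> le_nj le_jn; apply: anti_leq; rewrite le_nj. Qed.

(* The sequence (T_0, ..., T_{n-1}, E). *)
Definition obn_rcons n (G : obn n) (E : LM n) : obn n.+1 :=
  fun i => match i with
  | Ordinal j hj =>
      match ltnP j n with
      | LtnNotGeq lt_jn => G (Ordinal lt_jn)
      | GeqNotLtn le_nj =>
          eq_rect n LM E j (leq_ltS le_nj hj)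
      end
  end.

Arguments obn_rcons : simpl never.

Lemma obn_rcons_lt n (G : obn n) (E : LM n) j (h : j < n.+1) (h' : j < n) :
  obn_rcons G E (Ordinal h) = G (Ordinal h').
Proof.
rewrite /obn_rcons; case: (ltnP j n) => [lt|ge].
  by rewrite (bool_irrelevance lt h').
by exfalso; rewrite leqNgt h' in ge.
Qed.

Lemma obn_rcons_last n (G : obn n) (E : LM n) (h : n < n.+1) :
  obn_rcons G E (Ordinal h) = E.
Proof.
rewrite /obn_rcons; case: (ltnP n n) => [lt|ge].
  by exfalso; rewrite ltnn in lt.
by rewrite (Prop_irrelevance (leq_ltS _ _) erefl).
Qed.

Lemma obn_eq n (G G' : obn n) :
  (forall j (h : j < n), G (Ordinal h) = G' (Ordinal h)) -> G = G'.
Proof. by move=> e; apply: functional_extensionality_dep => -[]. Qed.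

Lemma obn_ft_rcons n (G : obn n) (E : LM n) : obn_ft (obn_rcons G E) = G.
Proof.
apply: obn_eq => j h; rewrite /obn_ft /=.
exact: (obn_rcons_lt G E (widen_ord_proof (Ordinal h) _) h).
Qed.

Lemma obn_rcons_ft n (G : obn n.+1) (h : n < n.+1) :
  obn_rcons (obn_ft G) (G (Ordinal h)) = G.
Proof.
apply: obn_eq => j hj.
have := hj; rewrite ltnS leq_eqVlt => /orP[/eqP e|lt_jn].
  by subst j; rewrite obn_rcons_last (bool_irrelevance h hj).
rewrite (obn_rcons_lt _ _ _ lt_jn).
rewrite /obn_ft /widen_ord /=.
by rewrite (bool_irrelevance (widen_ord_proof (Ordinal lt_jn) (leq_pred n.+1)) hj).
Qed.

Lemma pred_lt n : 0 < n -> n.-1 < n.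
Proof. by rewrite ltn_predL. Qed.

Definition cr_pull (X Y : cr_cat) (hX : 0 < projT1 X) (f : hom Y (cr_ft X)) :
    cr_cat :=
  existT obn _
    (obn_rcons (projT2 Y) (act f (projT2 X (Ordinal (pred_lt hX))))).

Definition cr_q (X Y : cr_cat) (hX : 0 < projT1 X) (f : hom Y (cr_ft X)) :
    hom (cr_pull hX f) X :=
  fun i => qq f (cast_ord (esym (prednK hX)) i).

Definition cr_sec (X Y : cr_cat) (hX : 0 < projT1 X) (f : hom Y X) :
    hom Y (cr_pull hX (f \o> cr_pr X)) :=
  snoc eta (f (Ordinal (pred_lt hX))).

Arguments cr_q [X Y] hX f.
Arguments cr_sec [X Y] hX f.

(* Hom-types of cr_cat only depend on lengths. *)
Lemma cr_mor n m (G G' : obn n) (D D' : obn m) (f f' : 'I_m -> RR n) :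
  G = G' -> D = D' -> f =1 f' ->
  @mor cr_cat (existT _ n G) (existT _ m D) f =
  @mor cr_cat (existT _ n G') (existT _ m D') f'.
Proof. by move=> -> -> /funext ->. Qed.

Lemma cr_castc (X : cr_cat) m (D D' : obn m)
    (e : existT _ m D = existT _ m D' :> cr_cat) (f : 'I_m -> RR (projT1 X)) :
  @castc cr_cat X _ _ e f = f.
Proof.
have eD := existT_inj e; subst D'.
by rewrite (Prop_irrelevance e erefl).
Qed.

Lemma ren_eta m n (f : 'I_m -> 'I_n) (i : 'I_m) :
  ren f (eta i) = eta (f i) :> RR n.
Proof. exact: (eta_rho (Lmor f) i). Qed.

Lemma rho_ren l m n (f : 'I_m -> RR n) (g : 'I_l -> 'I_m) (x : RR l) :
  rho f (ren g x) = rho (f \o g) x.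
Proof.
rewrite /ren rho_rho.
by congr (rho _ x); apply: funext => i /=; rewrite eta_rho.
Qed.

Lemma ren_rho l m n (f : 'I_m -> 'I_n) (g : 'I_l -> RR m) (x : RR l) :
  ren f (rho g x) = rho (ren f \o g) x.
Proof. exact: (rho_rho g (Lmor f) x). Qed.

Lemma qq_lt n m (f : 'I_n -> RR m) (i : 'I_n.+1) (j : 'I_n) :
  i = j :> nat -> qq f i = ren (@iota1 m) (f j).
Proof. by move=> e; rewrite /qq (snoc_lt _ _ e). Qed.

Lemma qq_max n m (f : 'I_n -> RR m) (i : 'I_n.+1) :
  i = n :> nat -> qq f i = eta ord_max.
Proof. exact: snoc_max. Qed.

Variant ord_spec n (i : 'I_n.+1) : Prop :=
  | OrdMax of i = n :> nat
  | OrdLt (j : 'I_n) of i = j :> nat.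

Lemma ordP n (i : 'I_n.+1) : ord_spec i.
Proof.
have := ltn_ord i; rewrite ltnS leq_eqVlt => /orP[/eqP|h]; first exact: OrdMax.
exact: (@OrdLt _ _ (Ordinal h)).
Qed.

Fact cr_len_eq0 (X : cr_cat) : projT1 X = 0 <-> X = cr_pt.
Proof.
split=> [|-> //]; case: X => n G /= e; subst n.
by congr existT; apply: obn_eq.
Qed.

Fact cr_ft_pt : cr_ft cr_pt = cr_pt.
Proof. by apply/cr_len_eq0. Qed.

Fact cr_pt_final (X : cr_cat) : exists! f : hom X cr_pt, True.
Proof.
exists (fun i : 'I_0 => False_rect _ (notF (ltn_ord i))); split=> // f _.
by apply: funext => -[].
Qed.

Fact cr_ft_pull (X Y : cr_cat) (hX : 0 < projT1 X) (f : hom Y (cr_ft X)) :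
  cr_ft (cr_pull hX f) = Y.
Proof. by case: Y f => m D f; rewrite /cr_ft /= obn_ft_rcons. Qed.

Fact cr_q_pr (X Y : cr_cat) (hX : 0 < projT1 X) (f : hom Y (cr_ft X)) :
  cr_q hX f \o> cr_pr X =
  castc (cr_ft_pull hX f) (cr_pr (cr_pull hX f)) \o> f.
Proof.
move: (cr_ft_pull hX f).
case: X hX f => [[|n] G] //= hX; case: Y => m D f e.
rewrite (@cr_castc _ m); apply: funext => i /=.
rewrite eta_rho /cr_q (@qq_lt _ _ _ _ i) // /ren; congr (rho _ (f i)).
by apply: funext => j; congr eta; apply: val_inj.
Qed.

Fact cr_pull_id (X : cr_cat) (hX : 0 < projT1 X) :
  cr_pull hX (idm (cr_ft X)) = X.
Proof.
case: X hX => [[|n] G] //= hX; rewrite /cr_pull /= act1.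
by congr existT; exact: obn_rcons_ft.
Qed.

Fact cr_q_id (X : cr_cat) (hX : 0 < projT1 X) :
  mor (cr_q hX (idm (cr_ft X))) = mor (idm X).
Proof.
have e := cr_pull_id hX; case: X hX e => [[|n] G] //= hX e.
apply: cr_mor => //; first exact: existT_inj e.
move=> i; rewrite /cr_q /=.
case: (ordP i) => [ei|j ej].
  rewrite qq_max //; congr eta; exact: val_inj.
rewrite (@qq_lt _ _ _ _ j) // ren_eta; congr eta; exact: val_inj.
Qed.

Fact cr_pull_cmp (X Y Z : cr_cat) (hX : 0 < projT1 X) (f : hom Y (cr_ft X))
    (g : hom Z Y) :
  cr_pull hX (g \o> f) =
  @cr_pull (cr_pull hX f) Z isT (castc (esym (cr_ft_pull hX f)) g).
Proof.
move: (esym _) => e; case: X hX f e => [[|n] G] //= hX; case: Y g => m D g f e.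
rewrite /cr_pull /= (@cr_castc Z m); congr existT; congr obn_rcons.
rewrite [LHS]actM; congr act; exact: (esym (@obn_rcons_last m _ _ _)).
Qed.

Fact cr_q_cmp (X Y Z : cr_cat) (hX : 0 < projT1 X) (f : hom Y (cr_ft X))
    (g : hom Z Y) :
  mor (cr_q hX (g \o> f)) =
  mor (cr_q (X := cr_pull hX f) isT (castc (esym (cr_ft_pull hX f)) g)
         \o> cr_q hX f).
Proof.
have := cr_pull_cmp hX f g.
move: (esym _) => e; case: X hX f e => [[|n] G] //= hX; case: Y g => m D g f e eo.
apply: cr_mor => //; first exact: existT_inj eo.
move=> i; rewrite (@cr_castc Z m) /= /cr_q.
case: (ordP i) => [ei|j ej].
  rewrite !qq_max // eta_rho qq_max //.
rewrite !(@qq_lt _ _ _ _ j) //= rho_ren ren_rho.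
congr (rho _ (f j)); apply: funext => k /=.
by rewrite (@qq_lt _ _ _ _ k).
Qed.

Definition cr_c0system : c0system :=
  @C0System cr_cat (@projT1 _ _) cr_pt cr_ft cr_pr cr_pull cr_q
    cr_len_eq0 (fun _ _ => erefl) cr_ft_pt cr_pt_final (fun _ _ _ _ => isT)
    cr_ft_pull cr_q_pr cr_pull_id cr_q_id cr_pull_cmp cr_q_cmp.

Fact cr_sec_pr (X Y : cr_c0system) (hX : 0 < len X) (f : hom Y X) :
  cr_sec hX f \o> castc (ft_pull1 hX (f \o> pr X)) (pr _) = idm Y.
Proof.
move: (ft_pull1 hX _) => e; case: Y f e => m D f e /=.
rewrite (@cr_castc _ m) /cr_sec /=; apply: funext => i /=.
by rewrite eta_rho (@snoc_lt _ _ _ _ _ i).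
Qed.

Fact cr_sec_q (X Y : cr_c0system) (hX : 0 < len X) (f : hom Y X) :
  cr_sec hX f \o> q1 hX (f \o> pr X) = f.
Proof.
case: X hX f => [[|n] G] //= hX f; apply: funext => i /=.
rewrite /cr_q /cr_sec; case: (ordP i) => [ei|j ej].
  rewrite qq_max // eta_rho snoc_max //; congr f; exact: val_inj.
rewrite (@qq_lt _ _ _ _ j) //= rho_ren eta_rho -[RHS]rho_eta.
have -> : widen_ord (leq_pred n.+1) j = i by apply: val_inj.
congr (rho _ (f i)); apply: funext => k /=.
by rewrite (@snoc_lt _ _ _ _ _ k).
Qed.

Fact cr_sec_nat (Z W Y : cr_c0system) (hZ : 0 < len Z) (g : hom W (ft Z))
    (f : hom Y (pull1 hZ g)) :
  mor (cr_sec (X := pull1 hZ g) isT f) = mor (cr_sec hZ (f \o> q1 hZ g)).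
Proof.
case: Z hZ g f => [[|n] G] //= hZ; case: W => w D g; case: Y => m B f.
rewrite /cr_pull /=; apply: cr_mor => // [|i]; last first.
  rewrite /cr_sec /= /cr_q qq_max //= eta_rho; congr (snoc _ (f _) _).
  exact: val_inj.
congr obn_rcons.
have E := @obn_rcons_last w D (act g (G (Ordinal (pred_lt hZ)))) (ltnSn w).
rewrite (bool_irrelevance (ltnSn w) (@pred_lt w.+1 isT)) in E.
apply: (etrans (congr1 (act _) E)); rewrite -actM; congr act.
apply: funext => i /=; rewrite eta_rho /cr_q /= (@qq_lt _ _ _ _ i) // rho_ren.
congr (rho _ (g i)); apply: funext => k /=; rewrite eta_rho; congr f.
exact: val_inj.
Qed.

Definition cr_csystem : csystem :=
  @CSystem cr_c0system cr_sec cr_sec_pr cr_sec_q cr_sec_nat.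

(* The set Ob~' and, below, the operations transported along mb; the inverse
   of mb is [mb_inv]. *)
Definition obt' : Type := {n : nat & (obn n.+1 * RR n)%type}.

Definition cobt (n : nat) (G : obn n.+1) (x : RR n) : obt' :=
  existT _ n (G, x).

Definition mb (s : obt cr_csystem) : obt' :=
  let: @Obt _ X hX f _ := s in
  match X return 0 < projT1 X -> @hom cr_cat (cr_ft X) X -> obt' with
  | existT n G =>
      match n return forall G : obn n, 0 < n -> ('I_n -> RR n.-1) -> obt' with
      | 0 => fun _ h _ => False_rect _ (notF h)
      | k.+1 => fun G _ f => existT _ k (G, f ord_max)
      end G
  end hX f.

Lemma mb_inv_subproof n (G : obn n.+1) (o : RR n) :
  (snoc eta o : @hom cr_csystem (cr_ft (existT _ n.+1 G)) (existT _ n.+1 G))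
    \o> pr (existT _ n.+1 G : cr_csystem) = idm _.
Proof.
apply: funext => i /=.
by rewrite eta_rho (@snoc_lt _ _ _ _ _ i).
Qed.

Definition mb_inv (o : obt') : obt cr_csystem :=
  let: existT n (G, x) := o in
  @Obt cr_csystem (existT _ n.+1 G) isT (snoc eta x) (mb_inv_subproof G x).

Lemma mb_invK : cancel mb_inv mb.
Proof. by case=> n [G x] /=; rewrite snoc_max. Qed.

Lemma mbK : cancel mb mb_inv.
Proof.
case=> -[[|n] G] // hX f ef /=.
have e : snoc eta (f ord_max) = f.
  apply: funext => i; case: (ordP i) => [ei|j ej].
    rewrite snoc_max //; congr f; exact: val_inj.
  rewrite (snoc_lt _ _ ej) -[LHS](congr1 (fun u => u j) ef) /= eta_rho.
  by congr f; apply: val_inj.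
move: (mb_inv_subproof G (f ord_max)); rewrite e => ef'.
by rewrite (bool_irrelevance hX isT) (Prop_irrelevance ef ef').
Qed.

Definition T'_dom (X Y : cr_csystem) : Prop := T_dom X Y.
Definition T' (X Y : cr_csystem) (h : T'_dom X Y) : cr_csystem := T_op h.

Definition Tt'_dom (X : cr_csystem) (s : obt') : Prop := Tt_dom X (mb_inv s).
Definition Tt' (X : cr_csystem) (s : obt') (h : Tt'_dom X s) : obt' :=
  mb (Tt_op h).

Definition S'_dom (r : obt') (Y : cr_csystem) : Prop := S_dom (mb_inv r) Y.
Definition S' (r : obt') (Y : cr_csystem) (h : S'_dom r Y) : cr_csystem :=
  S_op h.

Definition St'_dom (r s : obt') : Prop := St_dom (mb_inv r) (mb_inv s).
Definition St' (r s : obt') (h : St'_dom r s) : obt' := mb (St_op h).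

Definition delta'_dom (X : cr_csystem) : Prop := delta_dom X.
Definition delta' (X : cr_csystem) (h : delta'_dom X) : obt' :=
  mb (delta_op h).

(* The terms of index < k of both sequences are equal. *)
Definition agree k m n (G : obn m) (G' : obn n) : Prop :=
  forall i (hm : i < m) (hn : i < n), i < k -> G (Ordinal hm) = G' (Ordinal hn).

Lemma pred_leq m n : 0 < m -> m <= n -> m.-1 < n.
Proof. by move=> m0; rewrite prednK. Qed.

(* The sequence of length n + 1 with i-th term T_i if i < m, and with term of
   index k + 1 >= m the image of T'_k under the face map omitting m - 1. *)
Definition T_seq m n (hm : 0 < m) (G : obn m) (G' : obn n) : obn n.+1 :=
  fun i => match i with
  | Ordinal j hj =>
      match j return j < n.+1 -> LM j with
      | 0 => fun _ => G (Ordinal hm)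
      | k.+1 => fun hk =>
          match ltnP k.+1 m with
          | LtnNotGeq h => G (Ordinal h)
          | GeqNotLtn h =>
              renm (@face m.-1 k (pred_leq hm h)) (G' (Ordinal (hk : k < n)))
          end
      end hj
  end.

Lemma ltn_pred_S j n : j < n.-1 -> j.+1 < n.
Proof. by case: n. Qed.

(* The sequence of length n - 1 with j-th term T'_j if j < m, and
   theta_{m,j+1}(r, T'_{j+1}) if j >= m. *)
Definition S_seq m n (r : RR m) (G' : obn n) : obn n.-1 :=
  fun i => match i with
  | Ordinal j hj =>
      match ltnP j m with
      | LtnNotGeq _ => G' (Ordinal (leq_trans hj (leq_pred n)))
      | GeqNotLtn h =>
          @thetam RR LM m j.+1 h r (G' (Ordinal (ltn_pred_S hj)))
      end
  end.

End CRRLM.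

Arguments cob {RR LM} n G.
Arguments cobt {RR LM} n G x.
Arguments agree {RR LM} k {m n} G G'.

(* Main.v *)
Require Import Defs.
From mathcomp Require Import all_boot.
From mathcomp Require Import boolp.

Set Implicit Arguments.
Unset Strict Implicit.
Unset Printing Implicit Defensive.

(** In C(RR, LM) everything about an iterated pull-back f^*(X), along
    f : Y -> ft^i(X), can be read off the Kleisli maps qq^k(f).  Unfolding the
    recursion, q(f, X, i) is qq^i(f) ([kl_pullqn]), and f^*(X, i) consists of
    the terms of Y ([term_pullqn_lt]) followed by the terms of X with index at
    least l(ft^i(X)), the k-th of these acted on by qq^k(f)
    ([term_pullqn_ge]).  The pull-back f^*(s) of a section s is determined by
    f^*(s) o q(f, X) = q(f, ft(X)) o s, in diagrammatic order.  As q(f, X)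
    sends the last variable to the last variable, comparing last components
    shows that the last component of f^*(s) is qq^k(f) applied to that of s
    ([obs_pulls]), and the last component is all that mb retains.

    The formulas then come from the two choices of f.  The operations T and T~
    use f = p, which is the renaming along a face map omitting the last
    position; qq turns the face map omitting i on n points into the face map
    omitting i on n + 1 points ([qq_face]), so qq^k(p) is again a renaming
    along a face map.  The operations S and S~ use f = (x_0, ..., x_{m-1}, r),
    and qq^k(f) is the map defining theta up to arities ([kl_theta_mor]).  The
    operation delta is the section of Id, whose last component is the last
    variable, over p^*(Gamma), which is T(Gamma, Gamma).  The domains are
    identified by observing that X is over D exactly when the terms of D are
    the first terms of X ([over_agree]).

    The numbers of variables involved (such as l(f^*(X)) and i + l(Y)) agree
    only propositionally.  Kleisli maps and elements of RR and LM are therefore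
    compared after pairing them with their arities, so that equality needs no
    transport; an equality of such pairs with syntactically equal arities
    gives back an ordinary one. *)

(** * Kleisli maps tagged by their arities *)

Section TaggedKleisli.
Context (RR : rel_monad) (LM : lmodule RR).

Definition kl n m (f : 'I_n -> RR m) : {n : nat & {m : nat & 'I_n -> RR m}} :=
  @mor (kleisli RR) n m f.

Lemma kl_inj n m (f f' : 'I_n -> RR m) : kl f = kl f' -> f = f'.
Proof. exact: (@mor_inj (kleisli RR)). Qed.

Lemma kl_dom n m n' m' (f : 'I_n -> RR m) (f' : 'I_n' -> RR m') :
  kl f = kl f' -> n = n'.
Proof. exact: (@mor_dom (kleisli RR)). Qed.

Lemma kl_cod n m n' m' (f : 'I_n -> RR m) (f' : 'I_n' -> RR m') :
  kl f = kl f' -> m = m'.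
Proof. exact: (@mor_cod (kleisli RR)). Qed.

Lemma Tagged_inj (T : nat -> Type) n (x y : T n) :
  Tagged T x = Tagged T y -> x = y.
Proof. exact: existT_inj. Qed.

Lemma kl_act n m n' m' (f : 'I_n -> RR m) (f' : 'I_n' -> RR m') E E' :
  kl f = kl f' -> Tagged LM E = Tagged LM E' ->
  Tagged LM (act f E) = Tagged LM (act f' E').
Proof.
move=> ef; have en := kl_dom ef; have em := kl_cod ef; subst n' m'.
by rewrite (kl_inj ef) => ex; rewrite (Tagged_inj ex).
Qed.

Lemma kl_rho n m n' m' (f : 'I_n -> RR m) (f' : 'I_n' -> RR m') x x' :
  kl f = kl f' -> Tagged RR x = Tagged RR x' ->
  Tagged RR (rho f x) = Tagged RR (rho f' x').
Proof.
move=> ef; have en := kl_dom ef; have em := kl_cod ef; subst n' m'.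
by rewrite (kl_inj ef) => ex; rewrite (Tagged_inj ex).
Qed.

Lemma kl_app n m n' m' (f : 'I_n -> RR m) (f' : 'I_n' -> RR m')
    (i : 'I_n) (i' : 'I_n') :
  kl f = kl f' -> i = i' :> nat -> Tagged RR (f i) = Tagged RR (f' i').
Proof.
move=> ef; have en := kl_dom ef; have em := kl_cod ef; subst n' m'.
by rewrite (kl_inj ef) => ei; rewrite (val_inj ei).
Qed.

Lemma kl_qq n m n' m' (f : 'I_n -> RR m) (f' : 'I_n' -> RR m') :
  kl f = kl f' -> kl (qq f) = kl (qq f').
Proof.
move=> ef; have en := kl_dom ef; have em := kl_cod ef; subst n' m'.
by rewrite (kl_inj ef).
Qed.

Lemma kl_qqn i i' n m n' m' (f : 'I_n -> RR m) (f' : 'I_n' -> RR m') :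
  i = i' -> kl f = kl f' -> kl (qqn i f) = kl (qqn i' f').
Proof. by move=> <- ef; elim: i => //= i IH; exact: kl_qq. Qed.

Lemma kl_cast_dom n n' m (e : n' = n) (f : 'I_n -> RR m) :
  kl (fun i => f (cast_ord e i)) = kl f.
Proof.
subst n'; congr kl; apply: funext => i; congr f; exact: val_inj.
Qed.

Lemma kl_cast_cod n m m' (e : m = m') (f : 'I_n -> RR m) :
  kl (fun i => eq_rect m RR (f i) m' e) = kl f.
Proof. by subst m'. Qed.

(** Lifting adds one variable at the end, after the omitted position, so the
    omitted position stays the same. *)
Lemma qq_face i n (h : i < n.+1) (h' : i < n.+2) :
  qq (Lmor (face h)) = Lmor (face h') :> ('I_n.+1 -> RR n.+2).
Proof.
apply: funext => x; case: (ordP x) => [ex|y ey].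
  rewrite qq_max // /Lmor /=; congr eta; apply: val_inj => /=.
  by rewrite ex /bump -ltnS h.
rewrite (qq_lt _ ey) ren_eta /Lmor /=; congr eta; apply: val_inj => /=.
by rewrite ey.
Qed.

(** The base map omits the last position; this is the shape of a projection
    p, whence the face maps in the operations T and T~. *)
Lemma kl_qqn_face k m n (h : m < m.+1) (h' : m < n.+1) : k + m = n ->
  kl (qqn k (Lmor (face h))) = kl (Lmor (face h')).
Proof.
elim: k n h' => [|k IH] n h' e.
  by subst n; rewrite /= (bool_irrelevance h h').
subst n; have hk : m < (k + m).+1 by rewrite ltnS leq_addl.
by rewrite /= -(qq_face hk h'); apply/kl_qq/IH.
Qed.

(** The unit law, for an element known to be a variable only after its arity
    has been changed. *)
Lemma rho_tagged_eta m k (f : 'I_m -> RR k) x n (i : 'I_n) (i' : 'I_m) :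
  i = i' :> nat -> Tagged RR x = Tagged RR (eta i) -> rho f x = f i'.
Proof.
move=> ei ex; have en : m = n := congr1 (@projT1 _ _) ex; subst n.
by rewrite (Tagged_inj ex) eta_rho (val_inj ei).
Qed.

Lemma kl_theta_mor m n (h : m < n) (r : RR m) :
  kl (theta_mor h r) = kl (qqn (n - m.+1) (snoc eta r)).
Proof. by rewrite [LHS]kl_cast_cod kl_cast_dom. Qed.

End TaggedKleisli.

(** * Terms of objects and the order relation *)

Section Terms.
Context (RR : rel_monad) (LM : lmodule RR).
Notation C := (cr_csystem LM).
Implicit Types X Y D : C.

Lemma cr_eq X Y : len X = len Y ->
  (forall j (hX : j < len X) (hY : j < len Y),
     projT2 X (Ordinal hX) = projT2 Y (Ordinal hY)) -> X = Y.
Proof.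
case: X Y => [n G] [n' G'] /= e; subst n' => E.
by congr existT; apply: obn_eq.
Qed.

Lemma term_eq X j j' (h : j < len X) (h' : j' < len X) : j = j' ->
  Tagged LM (projT2 X (Ordinal h)) = Tagged LM (projT2 X (Ordinal h')).
Proof. by move=> e; subst j'; rewrite (bool_irrelevance h h'). Qed.

Lemma term_ft X j (h : j < len (ft X)) (h' : j < len X) :
  projT2 (ft X) (Ordinal h) = projT2 X (Ordinal h').
Proof.
case: X h h' => n G /= h h'; rewrite /obn_ft /widen_ord /=.
by rewrite (bool_irrelevance (widen_ord_proof (Ordinal h) (leq_pred n)) h').
Qed.

Lemma cr_len_ft X : len (ft X) = (len X).-1.
Proof. by []. Qed.

Lemma len_ftn i X : len (ftn i X) = len X - i.
Proof.
elim: i X => [|i IH] X /=; first by rewrite subn0.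
by rewrite [LHS]IH /= -subn1 -subnDA.
Qed.

Lemma term_ftn i X j (h : j < len (ftn i X)) (h' : j < len X) :
  projT2 (ftn i X) (Ordinal h) = projT2 X (Ordinal h').
Proof.
elim: i X h h' => [|i IH] X h h'; first by rewrite (bool_irrelevance h h').
have h1 : j < len (ft X).
  by apply: leq_trans (leq_subr i _); rewrite -len_ftn.
exact: (etrans (IH (ft X) h h1) (term_ft h1 h')).
Qed.

(** Since ft^i only truncates a sequence, being over D means extending D. *)
Lemma over_agree D X :
  Defs.over D X <-> len D <= len X /\ agree (len D) (projT2 D) (projT2 X).
Proof.
rewrite /Defs.over; split=> -[le_DX H]; split=> //.
  move=> j hD hX _.
  have hF : j < len (ftn (len X - len D) X) by rewrite -H.
  rewrite -(term_ftn hF hX).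
  by move: hF; rewrite -H => hF; rewrite (bool_irrelevance hF hD).
apply: cr_eq => [|j hD hF]; first by rewrite len_ftn subKn.
have hX := leq_trans hD le_DX.
by rewrite (term_ftn hF hX); apply: H.
Qed.

Lemma sover_agree D X :
  sover D X <-> len D < len X /\ agree (len D) (projT2 D) (projT2 X).
Proof.
rewrite /sover over_agree; split=> [[[_ ag] lt]|[lt ag]] //.
by split=> //; split=> //; apply: ltnW.
Qed.

(** The form in which the domains of T and T~ involve the order. *)
Lemma sover_ft_agree D X :
  sover (ft D) X <->
  (len D).-1 < len X /\ agree (len D).-1 (projT2 D) (projT2 X).
Proof.
rewrite sover_agree; split=> -[lt ag]; split=> // j hD hX hj.
  by rewrite -(ag j hj hX hj); rewrite (term_ft hj hD).
by rewrite (term_ft hD (leq_trans hD (leq_pred _))); apply: ag.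
Qed.

(** * Iterated pull-backs *)

Lemma kl_castc X Y Y' (e : Y = Y') (f : hom X Y) : kl (castc e f) = kl f.
Proof. by case: Y' / e. Qed.

Lemma kl_castd X X' Y (e : X = X') (f : hom X Y) : kl (castd e f) = kl f.
Proof. by case: X' / e. Qed.

Lemma kl_q1 X Y (hX : 0 < len X) (f : hom Y (ft X)) : kl (q1 hX f) = kl (qq f).
Proof. exact: kl_cast_dom. Qed.

Lemma kl_pullqn i X (h : i <= len X) Y (f : hom Y (ftn i X)) :
  kl (projT2 (pullqn h f)) = kl (qqn i f).
Proof.
elim: i X h Y f => [//|i IH] X h Y f.
by rewrite [LHS]kl_q1; apply: kl_qq; apply: IH.
Qed.

Lemma len_ftnK i X : i <= len X -> len (ftn i X) + i = len X.
Proof. by move=> h; rewrite len_ftn subnK. Qed.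

(** Truncating f^*(X, i) gives back Y, so Y provides its first terms. *)
Lemma term_pullqn_lt i X (h : i <= len X) Y (f : hom Y (ftn i X)) j
    (hP : j < len (projT1 (pullqn h f))) (hY : j < len Y) :
  projT2 (projT1 (pullqn h f)) (Ordinal hP) = projT2 Y (Ordinal hY).
Proof.
have hF : j < len (ftn i (projT1 (pullqn h f))) by rewrite pullqn_ftn.
rewrite -(term_ftn hF hP); move: hF; rewrite pullqn_ftn => hF.
by rewrite (bool_irrelevance hF hY).
Qed.

Lemma pull1_last X Y (hX : 0 < len X) (f : hom Y (ft X)) j
    (hP : j < len (pull1 hX f)) : j = len Y ->
  Tagged LM (projT2 (pull1 hX f) (Ordinal hP)) =
  Tagged LM (act f (projT2 X (Ordinal (pred_lt hX)))).
Proof.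
by move=> ej; subst j; apply: (congr1 (Tagged LM)); apply: obn_rcons_last.
Qed.

(** The k-th new term is the k-th term of X beyond ft^i(X), acted on by the
    k-fold lift of f.  The map g stands for qq^k(f) with arities rewritten, so
    the indices j and l of the two terms are dictated by the types. *)
Lemma term_pullqn_ge i X (h : i <= len X) Y (f : hom Y (ftn i X)) k j l
    (g : 'I_l -> RR j) (hP : j < len (projT1 (pullqn h f))) (hX : l < len X) :
  kl g = kl (qqn k f) ->
  projT2 (projT1 (pullqn h f)) (Ordinal hP) = act g (projT2 X (Ordinal hX)).
Proof.
move=> eg; have el := kl_dom eg; have ej := kl_cod eg.
elim: i X h Y f hP hX eg el ej => [|i IH] X h Y f hP hX eg el ej.
  by exfalso; move: hX; rewrite el ltnNge leq_addl.
pose h1 := leq_len_ft h.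
have e1 : i + len (ftn i (ft X)) = len (ft X) by rewrite addnC len_ftnK.
have : k <= i by rewrite -ltnS -(ltn_add2r (len Y)) -ej -(pullqn_len h f).
(* Either the term is the one added by the last pull-back step, or it already
   occurs in the pull-back of ft(X). *)
rewrite leq_eqVlt => /orP[/eqP ek|lt_ki].
  apply: (@Tagged_inj LM); rewrite pull1_last; last by rewrite pullqn_len -ek.
  apply: kl_act; first by rewrite eg ek; apply: kl_pullqn.
  by apply: term_eq; rewrite el ek; apply: (esym e1).
have hP1 : j < len (projT1 (pullqn h1 f)).
  by rewrite pullqn_len ej ltn_add2r.
have hX1 : l < len (ft X) by rewrite -e1 el ltn_add2r.
have eP : ft (projT1 (pullqn h f)) = projT1 (pullqn h1 f) by exact: ft_pull1.
have hP2 : j < len (ft (projT1 (pullqn h f))) by rewrite eP.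
rewrite -(term_ft hP2 hP) -(term_ft hX1 hX) -(IH _ h1 _ f hP1 hX1) //.
by move: hP2; rewrite eP => hP2; rewrite (bool_irrelevance hP2 hP1).
Qed.

(** * The sequences of T and S as iterated pull-backs *)

Lemma T_seq_lt m n (hm : 0 < m) (G : obn LM m) (G' : obn LM n) j
    (h : j < n.+1) (h' : j < m) : T_seq hm G G' (Ordinal h) = G (Ordinal h').
Proof.
case: j h h' => [|k] h h' /=; first by rewrite (bool_irrelevance hm h').
case: ltnP => [lt|ge]; first by rewrite (bool_irrelevance lt h').
by exfalso; rewrite leqNgt h' in ge.
Qed.

Lemma T_seq_ge m n (hm : 0 < m) (G : obn LM m) (G' : obn LM n) k
    (h : k.+1 < n.+1) (h' : k < n) (hf : m.-1 < k.+1) : m <= k.+1 ->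
  T_seq hm G G' (Ordinal h) = renm (face hf) (G' (Ordinal h')).
Proof.
move=> le_mk /=; case: ltnP => [lt|ge].
  by exfalso; rewrite ltnNge le_mk in lt.
by rewrite (bool_irrelevance (pred_leq hm ge) hf)
           (bool_irrelevance (h : k < n) h').
Qed.

Lemma S_seq_lt m n (r : RR m) (G' : obn LM n) j (h : j < n.-1) (h' : j < n) :
  j < m -> S_seq r G' (Ordinal h) = G' (Ordinal h').
Proof.
move=> lt_jm /=; case: ltnP => [lt|ge]; last first.
  by exfalso; rewrite leqNgt lt_jm in ge.
by rewrite (bool_irrelevance (leq_trans h (leq_pred n)) h').
Qed.

Lemma S_seq_ge m n (r : RR m) (G' : obn LM n) j (h : j < n.-1) (h' : j.+1 < n)
    (hm : m < j.+1) :
  S_seq r G' (Ordinal h) = thetam hm r (G' (Ordinal h')).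
Proof.
move=> /=; case: ltnP => [lt|ge].
  by exfalso; rewrite ltnNge -ltnS hm in lt.
by rewrite (bool_irrelevance ge hm) (bool_irrelevance (ltn_pred_S h) h').
Qed.

Lemma kl_pr m (G : obn LM m) (hm : 0 < m) (h : m.-1 < m.-1.+1) :
  kl (pr (cob m G : C)) = kl (Lmor (face h) : _ -> RR _).
Proof.
case: m G hm h => // m G _ h; congr kl; apply: funext => j.
by congr eta; apply: val_inj; rewrite /= /bump leqNgt ltn_ord.
Qed.

(** Stated for an arbitrary i rather than for the operation T, because the
    case i = 1 also describes the object over which delta is a section. *)
Lemma pullqn_T_seq i m n (G : obn LM m) (G' : obn LM n) (hm : 0 < m)
    (h : i <= len (cob n G' : C))
    (f : hom (cob m G : C) (ftn i (cob n G' : C))) :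
  i + m.-1 = n -> kl f = kl (pr (cob m G : C)) ->
  projT1 (pullqn h f) = cob n.+1 (T_seq hm G G').
Proof.
move=> en ef; apply: cr_eq => [|j hP hT].
  by rewrite pullqn_len /= -en -[in LHS](prednK hm) addnS.
case: (ltnP j m) => [lt_jm|].
  by rewrite (term_pullqn_lt hP lt_jm); apply/esym/T_seq_lt.
case: j hP hT => [|k] hP hT le_mk; first by rewrite leqNgt hm in le_mk.
rewrite [RHS](@T_seq_ge _ _ _ _ _ _ hT hT (pred_leq hm le_mk)) //.
apply: (@term_pullqn_ge i _ h _ f (k - m.-1)).
have le : m.-1 <= k by rewrite -ltnS prednK.
rewrite -(@kl_qqn_face _ (k - m.-1) _ _ (ltnSn _)) ?subnK //.
by apply: kl_qqn => //; rewrite ef; apply/esym/kl_pr.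
Qed.

Lemma pullqn_S_seq i m n (D : obn LM m) (G' : obn LM n) (r : RR m)
    (h : i <= len (cob n G' : C))
    (f : hom (cob m D : C) (ftn i (cob n G' : C))) :
  i + m.+1 = n -> kl f = kl (snoc eta r) ->
  agree m D G' ->
  projT1 (pullqn h f) = cob n.-1 (S_seq r G').
Proof.
move=> en ef ag; apply: cr_eq => [|j hP hS].
  by rewrite pullqn_len /= -en addnS.
have hn : j.+1 < n by move: hS => /=; case: (n).
case: (ltnP j m) => [lt_jm|le_mj].
  rewrite (term_pullqn_lt hP lt_jm) [RHS](@S_seq_lt _ _ _ _ _ hS (ltnW hn)) //.
  exact: ag.
rewrite [RHS](@S_seq_ge _ _ _ _ _ hS hn le_mj).
apply: (@term_pullqn_ge i _ h _ f (j - m)).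
by rewrite kl_theta_mor; apply: kl_qqn; rewrite ?subSS.
Qed.

(** * Sections *)

Lemma mb_eq (s : obt C) n (D : obn LM n.+1) (x : RR n) (h : n < len (bd s)) :
  bd s = cob n.+1 D -> Tagged RR (obs s (Ordinal h)) = Tagged RR x ->
  mb s = cobt n D x.
Proof.
case: s h => X hX f ef /= h e; subst X => /= ex; rewrite -(Tagged_inj ex).
by congr (cobt _ _ (f _)); apply: val_inj.
Qed.

Lemma kl_q D X (h : Defs.over D X) Y (f : hom Y D) :
  kl (q h f) = kl (qqn (len X - len D) f).
Proof. by rewrite [LHS]kl_pullqn; apply: kl_qqn => //; apply: kl_castc. Qed.

(** The last component of f^*(s).  Both sides of
    f^*(s) o q(f, X) = q(f, ft(X)) o s are evaluated at the last variable,
    which q(f, X) preserves because at least one lifting step is made.  As in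
    [term_pullqn_ge], g and x stand for the lift of f and the last component
    of s with arities rewritten. *)
Lemma obs_pulls D (s : obt C) (h : sover D (bd s)) Y (f : hom Y D) j l
    (hP : j < len (bd (pulls h f))) (hX : l < len (bd s))
    (g : 'I_l -> RR j) (x : RR l) :
  l.+1 = len (bd s) -> kl g = kl (qqn (l - len D) f) ->
  Tagged RR (obs s (Ordinal hX)) = Tagged RR x ->
  Tagged RR (obs (pulls h f) (Ordinal hP)) = Tagged RR (rho g x).
Proof.
move=> el eg ex; pose b := pullm (morover_obs h) f.
have ej := kl_cod eg.
have le_Dl : len D <= l by rewrite -ltnS el; have [_] := h.
have hb : j < len (pull h.1 f) by exact: hP.
rewrite (kl_app (kl_castd (ft_pull h f) b) (i' := Ordinal hb)) //.
have [_ sq] := pullmP (morover_obs h) f.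
have {sq} sq : rho b (q h.1 f (Ordinal hX)) =
    rho (q (over_ft h) f) (obs s (Ordinal hX)).
  exact: (congr1 (fun u => u (Ordinal hX)) sq).
transitivity (Tagged RR (rho (q (over_ft h) f) (obs s (Ordinal hX))));
  last first.
  apply: kl_rho => //; rewrite kl_q eg; apply: kl_qqn => //.
  by rewrite cr_len_ft -el.
congr (Tagged RR _); rewrite -sq; apply/esym.
have lt_l : l < (l - len D + len D).+1 by rewrite subnK.
have ek : len (bd s) - len D = (l - len D).+1 by rewrite -el subSn.
apply: (@rho_tagged_eta RR _ _ _ _ _ (@ord_max (l - len D + len Y))).
  by rewrite /= ej.
rewrite -(@qq_max RR _ _ (qqn (l - len D) f) (Ordinal lt_l)) /=; last first.
  by rewrite subnK.
by apply: kl_app => //; rewrite kl_q ek.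
Qed.

End Terms.

(** * The transported operations *)

Section Operations.
Context (RR : rel_monad) (LM : lmodule RR).
Notation C := (cr_csystem LM).

Lemma T'_domP m (G : obn LM m) n (G' : obn LM n) :
  T'_dom (cob m G) (cob n G') <-> [/\ 0 < m, m.-1 < n & agree m.-1 G G'].
Proof.
rewrite /T'_dom /T_dom sover_ft_agree /=.
by split=> [[? [? ?]]|[? ? ?]]; split.
Qed.

Lemma T'E m (G : obn LM m) n (G' : obn LM n) (hm : 0 < m)
    (h : T'_dom (cob m G) (cob n G')) : T' h = cob n.+1 (T_seq hm G G').
Proof.
have [_ lt _] := iffLR (T'_domP G G') h.
apply: pullqn_T_seq; last exact: kl_castc.
by rewrite /= subnK // ltnW.
Qed.

Lemma S'_domP m (G : obn LM m.+1) (r : RR m) n (G' : obn LM n) :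
  S'_dom (cobt m G r) (cob n G') <-> m.+1 < n /\ agree m.+1 G G'.
Proof. exact: sover_agree. Qed.

Lemma S'E m (G : obn LM m.+1) (r : RR m) n (G' : obn LM n)
    (h : S'_dom (cobt m G r) (cob n G')) : S' h = cob n.-1 (S_seq r G').
Proof.
have [lt ag] := iffLR (S'_domP G r G') h.
apply: pullqn_S_seq; last 1 first.
- move=> j hm hn _; have hj := ltnW hm.
  apply: (etrans (@term_ft _ LM (cob m.+1 G) j hm hj)).
  by apply: ag.
- by rewrite /= subnK // ltnW.
- exact: kl_castc.
Qed.

Lemma obs_mb_inv n (G : obn LM n.+1) (x : RR n)
    (h : n < len (bd (mb_inv (cobt n G x)))) :
  Tagged RR (obs (mb_inv (cobt n G x)) (Ordinal h)) = Tagged RR x.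
Proof. by rewrite /= snoc_max. Qed.

Lemma Tt'E m (G : obn LM m) n (G' : obn LM n.+1) (s : RR n)
    (hmn : m.-1 < n.+1) (hT : T'_dom (cob m G) (cob n.+1 G'))
    (h : Tt'_dom (cob m G) (cobt n G' s)) (D : obn LM n.+2) :
  T' hT = cob n.+2 D -> Tt' h = cobt n.+1 D (ren (face hmn) s).
Proof.
have [hm _ _] := iffLR (T'_domP G G') hT.
move=> eT; have eb : bd (Tt_op h) = cob n.+2 D.
  by rewrite -eT (Prop_irrelevance hT h).
have hl : n.+1 < len (bd (Tt_op h)) by rewrite eb.
apply: (mb_eq (h := hl) eb).
apply: (@obs_pulls RR LM _ _ h.2 _ (pr (cob m G : C)) _ n hl (ltnSn n)) => //;
  last exact: obs_mb_inv.
rewrite -(@kl_qqn_face _ (n - m.-1) _ _ (ltnSn _)) ?subnK //.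
by apply: kl_qqn => //; apply/esym/kl_pr.
Qed.

Lemma St'E m (G : obn LM m.+1) (r : RR m) n (G' : obn LM n.+1) (s : RR n)
    (hmn : m < n) (hS : S'_dom (cobt m G r) (cob n.+1 G'))
    (h : St'_dom (cobt m G r) (cobt n G' s)) (D : obn LM n.-1.+1) :
  S' hS = cob n.-1.+1 D -> St' h = cobt n.-1 D (theta hmn r s).
Proof.
move=> eS; have eb : bd (St_op h) = cob n.-1.+1 D.
  by rewrite -eS (Prop_irrelevance hS h).
have hl : n.-1 < len (bd (St_op h)) by rewrite eb.
apply: (mb_eq (h := hl) eb).
apply: (@obs_pulls RR LM _ _ h _ (obs (mb_inv (cobt m G r))) _ n hl
          (ltnSn n)) => //; last exact: obs_mb_inv.
exact: kl_theta_mor.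
Qed.

Lemma delta'E m (G : obn LM m) (hm : 0 < m) (hm1 : m.-1 < m)
    (h : delta'_dom (cob m G)) :
  delta' h = cobt m (T_seq hm G G) (eta (Ordinal hm1)).
Proof.
have eb : bd (delta_op h) = cob m.+1 (T_seq hm G G).
  (* A single pull-back is an iterated one with i = 1. *)
  rewrite /= (bool_irrelevance h (@len_gt0 C 0 (cob m G) hm)).
  apply: (@pullqn_T_seq _ _ 1 _ _ _ _ hm hm); first by rewrite /= add1n prednK.
  exact: (congr1 (@kl RR _ _) (@cmp1m C _ _ (pr (cob m G : C)))).
have hl : m < len (bd (delta_op h)) by rewrite eb.
apply: (mb_eq (h := hl) eb).
pose e := esym (ft_pull1 h (idm (cob m G : C) \o> pr (cob m G : C))).
apply: (etrans (kl_app (kl_castd e (sec h (idm (cob m G : C))))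
                       (erefl : Ordinal hl = Ordinal hl :> nat))).
apply: (congr1 (Tagged RR)); rewrite /= /cr_sec snoc_max //.
by congr eta; apply: val_inj.
Qed.

End Operations.

Theorem
 theorem0p6p10 (RR : rel_monad) (LM : lmodule RR) :
  [/\ (* 1 *)
      (forall (m : nat) (G : obn LM m) (n : nat) (G' : obn LM n),
         T'_dom (cob m G) (cob n G') <->
         [/\ 0 < m, m.-1 < n & agree m.-1 G G']) /\
      (forall (m : nat) (G : obn LM m) (n : nat) (G' : obn LM n) (hm : 0 < m)
              (h : T'_dom (cob m G) (cob n G')),
         T' h = cob n.+1 (T_seq hm G G')),
      (* 2 *)
      (forall (m : nat) (G : obn LM m) (n : nat) (G' : obn LM n.+1) (s : RR n),
         Tt'_dom (cob m G) (cobt n G' s) <->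
         [/\ 0 < m, m.-1 < n.+1 & agree m.-1 G G']) /\
      (forall (m : nat) (G : obn LM m) (n : nat) (G' : obn LM n.+1) (s : RR n)
              (hmn : m.-1 < n.+1) (h : Tt'_dom (cob m G) (cobt n G' s)),
         exists (hT : T'_dom (cob m G) (cob n.+1 G')) (D : obn LM n.+2),
           T' hT = cob n.+2 D /\
           Tt' h = cobt n.+1 D (ren (face hmn) s)),
      (* 3 *)
      (forall (m : nat) (G : obn LM m.+1) (r : RR m) (n : nat) (G' : obn LM n),
         S'_dom (cobt m G r) (cob n G') <->
         m.+1 < n /\ agree m.+1 G G') /\
      (forall (m : nat) (G : obn LM m.+1) (r : RR m) (n : nat) (G' : obn LM n)
              (h : S'_dom (cobt m G r) (cob n G')),
         S' h = cob n.-1 (S_seq r G')),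
      (* 4 *)
      (forall (m : nat) (G : obn LM m.+1) (r : RR m)
              (n : nat) (G' : obn LM n.+1) (s : RR n),
         St'_dom (cobt m G r) (cobt n G' s) <->
         m < n /\ agree m.+1 G G') /\
      (forall (m : nat) (G : obn LM m.+1) (r : RR m)
              (n : nat) (G' : obn LM n.+1) (s : RR n)
              (hmn : m < n) (h : St'_dom (cobt m G r) (cobt n G' s)),
         exists (hS : S'_dom (cobt m G r) (cob n.+1 G')) (D : obn LM n.-1.+1),
           S' hS = cob n.-1.+1 D /\
           St' h = cobt n.-1 D (theta hmn r s)) &
      (* 5 *)
      (forall (m : nat) (G : obn LM m), delta'_dom (cob m G) <-> 0 < m) /\
      (forall (m : nat) (G : obn LM m) (hm : m.-1 < m)
              (h : delta'_dom (cob m G)),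
         exists (hT : T'_dom (cob m G) (cob m G)) (D : obn LM m.+1),
           T' hT = cob m.+1 D /\
           delta' h = cobt m D (eta (Ordinal hm)))].
Proof.
split.
- split; first exact: T'_domP.
  by move=> m G n G' hm h; apply: T'E.
- split; first by move=> m G n G' s; apply: T'_domP.
  move=> m G n G' s hmn h; have [hm _ _] := iffLR (T'_domP G G') h.
  exists h, (T_seq hm G G'); have eT := T'E hm h.
  by split=> //; apply: Tt'E eT.
- split; first exact: S'_domP.
  by move=> m G r n G' h; apply: S'E.
- split; first by move=> m G r n G' s; apply: S'_domP.
  move=> m G r [//|n] G' s hmn h.
  exists h, (S_seq r G'); have eS := S'E h.
  by split=> //; apply: St'E eS.
split=> // m G hm1 h; have hT : T'_dom (cob m G) (cob m G).
  by apply/T'_domP; split=> // i hi hi' _; rewrite (bool_irrelevance hi hi').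
exists hT, (T_seq h G G); split; first exact: T'E.
exact: delta'E.
Qed.
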